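(* Let $\mathcal{L}$ be a complete modular lattice and let $\mathfrak{m}$ be a submonoid with zero of $\mathrm{End}_{lin}(\mathcal{L})$ that is closed under complements. The following conditions are equivalent: (a) $\mathcal{L}$ is $\mathfrak{m}$-Rickart, dual-$\mathfrak{m}$-Rickart, and $\mathfrak{m}$-abelian. (b) $\mathbf{0}=\varphi(\mathbf{1})\wedge\ker_\varphi$ and $\mathbf{1}=\ker_\varphi\vee\varphi(\mathbf{1})$ for all $\varphi\in\mathfrak{m}$.
   Context: $\mathbf{0},\mathbf{1}$ denote the least and greatest elements; $[a,b]=\{x: a\le x\le b\}$. An element $x$ has a complement if there is $x'$ with $x\wedge x'=\mathbf{0}$, $x\vee x'=\mathbf{1}$. Linear morphism: a map $\varphi:\mathcal{L}\to\mathcal{L}'$ between bounded lattices is linear if there exist $\ker_\varphi\in\mathcal{L}$ (the kernel) and $a'\in\mathcal{L}'$ such that (1) $\varphi(x)=\varphi(x\vee\ker_\varphi)$ for all $x$; (2) $\varphi$ restricts to a lattice isomorphism $[\ker_\varphi,\mathbf{1}]\to[\mathbf{0},a']$ (so $a'=\varphi(\mathbf{1})$). $\mathrm{End}_{lin}(\mathcal{L})$ is the monoid of linear morphisms $\mathcal{L}\to\mathcal{L}$ under composition; its zero is the constant map $\mathbf{0}$. A submonoid with zero contains the identity and the zero morphism. For $x$ with complement $x'$, the projection $\pi_x$ (with respect to $x'$) is $\pi_x(a)=(a\vee x')\wedge x$, viewed with codomain $\mathcal{L}$ or $[\mathbf{0},x]$; $\iota_x:[\mathbf{0},x]\to\mathcal{L}$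 is the inclusion. $\mathfrak{m}$ is closed under complements if for every $\varphi\in\mathfrak{m}$ and all $x,y$ having complements in $\mathcal{L}$ such that $\varphi$ restricts to an isomorphism $\varphi|_x:[\mathbf{0},x]\to[\mathbf{0},y]$, one has $\iota_x(\varphi|_x)^{-1}\pi_y\in\mathfrak{m}$ (for every choice of complement of $y$ defining $\pi_y$). $\mathcal{L}$ is $\mathfrak{m}$-Rickart if $\ker_\varphi$ has a complement for all $\varphi\in\mathfrak{m}$; dual-$\mathfrak{m}$-Rickart if $\varphi(\mathbf{1})$ has a complement for all $\varphi\in\mathfrak{m}$; $\mathfrak{m}$-abelian if every idempotent of $\mathfrak{m}$ is central in $\mathfrak{m}$. *)

(* Defs.v *)
From mathcomp Require Import all_boot all_order.
From mathcomp Require Import boolp classical_sets functions.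

Set Implicit Arguments.
Unset Strict Implicit.
Unset Printing Implicit Defensive.

Import Order.TTheory.
Local Open Scope order_scope.

Section Lattices.
Variables (d : Order.disp_t) (L : tbLatticeType d).

Definition modular_lattice : Prop :=
  forall x y z : L, x <= z -> x `|` (y `&` z) = (x `|` y) `&` z.

Definition complete_lattice : Prop :=
  forall A : set L, (supremums A !=set0)%classic /\ (infimums A !=set0)%classic.

Definition segment (a b : L) : set L := [set x | a <= x <= b]%classic.

Definition complement (x x' : L) : Prop := x `&` x' = \bot /\ x `|` x' = \top.

Definition has_complement (x : L) : Prop := exists x', complement x x'.

(* The projection onto [\bot, x] with respect to a complement x' of x. *)
Definition proj (x x' : L) (a : L) : L := (a `|` x') `&` x.

End Lattices.

Section LinearMorphisms.
Variables (d d' : Order.disp_t) (L : tbLatticeType d) (L' : tbLatticeType d').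

(* f restricts to a lattice isomorphism [a, b] -> [a', b']; intervals are
   sublattices, so meets and joins are computed in L and in L'. *)
Definition segment_iso (f : L -> L') (a b : L) (a' b' : L') : Prop :=
  [/\ set_bij (segment a b) (segment a' b') f,
      forall x y, segment a b x -> segment a b y ->
        f (x `&` y) = f x `&` f y
    & forall x y, segment a b x -> segment a b y ->
        f (x `|` y) = f x `|` f y].

Definition is_kernel (f : L -> L') (k : L) : Prop :=
  (forall x, f x = f (x `|` k)) /\ exists a', segment_iso f k \top \bot a'.

Definition linear_morphism (f : L -> L') : Prop := exists k, is_kernel f k.

(* Kernels are unique (is_kernel_uniq); the default value \bot is only taken
   when f is not linear. *)
Definition ker (f : L -> L') : L := xget \bot [set k | is_kernel f k]%classic.

Lemma is_kernel_ker (f : L -> L') : linear_morphism f -> is_kernel f (ker f).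
Proof. exact: xgetPex. Qed.

Lemma is_kernelE (f : L -> L') (k x : L) :
  is_kernel f k -> f x = \bot <-> x <= k.
Proof.
case=> fk [a' [[_ fI fO] _ fU]].
have kk : segment k \top k by rewrite /segment /= lexx lex1.
have fk0 : f k = \bot.
  have [|y ky fy] := fO \bot; first by rewrite /segment /= lexx le0x.
  have := fU _ _ kk ky; rewrite fy joinx0 => <-.
  by have /andP[/join_r -> _] := ky.
split=> [fx0|/join_r xk]; last by rewrite fk xk.
have xkk : x `|` k = k.
  apply: fI; last by rewrite -fk fx0.
  - by apply/mem_set; rewrite /segment /= leUr lex1.
  - exact/mem_set.
by rewrite -xkk leUl.
Qed.

Lemma is_kernel_uniq (f : L -> L') (k k' : L) :
  is_kernel f k -> is_kernel f k' -> k = k'.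
Proof.
move=> fk fk'; apply/le_anti/andP; split.
- by apply/(is_kernelE _ fk')/(is_kernelE _ fk).
- by apply/(is_kernelE _ fk)/(is_kernelE _ fk').
Qed.

Lemma ker_eq (f : L -> L') (k : L) : is_kernel f k -> ker f = k.
Proof.
by move=> fk; apply: (xget_unique _ fk) => k' fk'; apply: is_kernel_uniq fk' fk.
Qed.

End LinearMorphisms.

Section EndomorphismMonoids.
Variables (d : Order.disp_t) (L : tbLatticeType d).
Implicit Types m : set (L -> L).

Definition submonoid_with_zero m : Prop :=
  [/\ forall f, m f -> linear_morphism f,
      m idfun,
      m (fun=> \bot)
    & forall f g, m f -> m g -> m (f \o g)].

(* 'pinv_(fun=> \bot) (segment \bot x) f is the inverse of the restriction of f
   to [\bot, x]; it takes the values of proj y y', which lie in [\bot, y], back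
   into [\bot, x]. *)
Definition closed_under_complements m : Prop :=
  forall (f : L -> L) (x y y' : L),
    m f -> has_complement x -> complement y y' ->
    segment_iso f \bot x \bot y ->
    m ('pinv_(fun=> \bot) (segment \bot x) f \o proj y y').

Definition rickart m : Prop := forall f, m f -> has_complement (ker f).

Definition dual_rickart m : Prop := forall f, m f -> has_complement (f \top).

Definition abelian m : Prop :=
  forall e, m e -> e \o e = e -> forall f, m f -> e \o f = f \o e.

End EndomorphismMonoids.

(* Main.v *)
Require Import Defs.
From mathcomp Require Import all_boot all_order.
From mathcomp Require Import boolp classical_sets functions.

Set Implicit Arguments.
Unset Strict Implicit.
Unset Printing Implicit Defensive.

Import Order.TTheory.
Local Open Scope order_scope.

(** The proof transports the classical argument on strongly regular rings to
lattices, with the projections [proj x x'] in the role of idempotents and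
[proj x' x] in the role of the complementary idempotent [1 - e].  Applied to
the identity, closure under complements puts every projection in [m]
([m_proj]).

(a) => (b).  If [f] is in [m], the projection [e] onto [f \top] and the
projection [h] along [ker f] are central in [m], and satisfy [e \o f = f] and
[f \o h = f].  Commuting gives [f = h \o f], so the image of [f] lies below the
chosen complement of [ker f], and [f = f \o e], so [f] kills the chosen
complement of [f \top].  The first says that [f \top] and [ker f] are disjoint,
the second that they join to [\top].

(b) => (a).  Both complements are given by the hypothesis, only centrality of
idempotents is at stake.  An idempotent is the projection onto its image along
its kernel ([idempotent_proj]).  Under (b) an element of square zero vanishes
([square_zero]), and for complementary [x] and [x'] the composite
[proj x' x \o f \o proj x x'], the analogue of [(1 - e) f e], has square zero;
hence [f x <= x] ([image_stable]).  By symmetry [f x' <= x'], and a join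
preserving map that respects both summands commutes with the projection. *)

Section Projections.
Variables (d : Order.disp_t) (L : tbLatticeType d).
Hypothesis L_modular : modular_lattice L.
Implicit Types a x : L.

Lemma complement_sym x x' : complement x x' -> complement x' x.
Proof. by case=> xx' xUx'; rewrite /complement meetC joinC. Qed.

Lemma proj_le x x' a : proj x x' a <= x.
Proof. exact: leIr. Qed.

Lemma proj_top x x' : proj x x' \top = x.
Proof. by rewrite /proj join1x meet1x. Qed.

Lemma proj_id x x' a : complement x x' -> a <= x -> proj x x' a = a.
Proof.
by move=> [xx' _] ax; rewrite /proj -L_modular // meetC xx' joinx0.
Qed.

(** With [x' <= a `|` x'], this is the modular law once more; it says that [a]
and its projection differ only by the summand [x'] that is projected away. *)
Lemma join_proj x x' a : complement x x' -> proj x x' a `|` x' = a `|` x'.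
Proof.
move=> [_ xUx'].
by rewrite /proj joinC meetC L_modular ?leUr // (joinC x') xUx' meet1x.
Qed.

Lemma proj_eq0 x x' a : complement x x' -> proj x x' a = \bot <-> a <= x'.
Proof.
move=> xx'; split=> [ax|/join_r ax]; last first.
  by case: (xx') => xIx' _; rewrite /proj ax meetC.
by rewrite leEjoin -(join_proj _ xx') ax join0x.
Qed.

End Projections.

Section LinearEndomorphisms.
Variables (d : Order.disp_t) (L : tbLatticeType d).
Variable f : L -> L.
Hypothesis f_linear : linear_morphism f.
Implicit Types a b x y : L.

Lemma linear_ker a : f a = f (a `|` ker f).
Proof. by case: (is_kernel_ker f_linear) => fk _; exact: fk. Qed.

Lemma linear_eq0 a : f a = \bot <-> a <= ker f.
Proof. exact/is_kernelE/is_kernel_ker. Qed.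

(** The isomorphism is only required on [[ker f, \top]], and joining with
[ker f] reduces every join to that segment. *)
Lemma linear_join a b : f (a `|` b) = f a `|` f b.
Proof.
have [_ [a' [_ _ fU]]] := is_kernel_ker f_linear.
rewrite (linear_ker a) (linear_ker b) -fU; last 2 first.
- by rewrite /segment /= leUr lex1.
- by rewrite /segment /= leUr lex1.
by rewrite joinACA joinxx -linear_ker.
Qed.

Lemma linear_mono a b : a <= b -> f a <= f b.
Proof. by move=> /join_r <-; rewrite linear_join leUl. Qed.

Lemma linear_le_top a : f a <= f \top.
Proof. exact/linear_mono/lex1. Qed.

(** Linear morphisms map onto a whole lower segment; this is the property that
makes idempotents act as the identity below their image. *)
Lemma linear_surj y : y <= f \top -> exists x, f x = y.
Proof.
have [_ [a' [[f_fun _ f_surj] _ _]]] := is_kernel_ker f_linear.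
have /f_fun/andP[_ fa'] : segment (ker f) \top \top by rewrite /segment /= !lex1.
move=> yf; have [|x _ <-] := f_surj y; last by exists x.
by rewrite /segment /= le0x (le_trans yf).
Qed.

Lemma idempotent_id y : f \o f = f -> y <= f \top -> f y = y.
Proof. by move=> ff /linear_surj[x <-]; rewrite -[in RHS]ff. Qed.

(** Modulo [ker f], every [a] agrees with its projection onto [f \top], and [f]
fixes that projection. *)
Lemma idempotent_proj : modular_lattice L -> f \o f = f ->
  complement (f \top) (ker f) -> f = proj (f \top) (ker f).
Proof.
move=> L_modular ff fK; apply/funext => a.
by rewrite linear_ker -(join_proj L_modular _ fK) -linear_ker idempotent_id
  ?proj_le.
Qed.

(** The image of such an [f] lies in its kernel, from which it is disjoint. *)
Lemma square_zero a : f \top `&` ker f = \bot -> (forall a, f (f a) = \bot) ->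
  f a = \bot.
Proof.
move=> f0 ff; have : f \top <= ker f by apply/linear_eq0.
move=> /meet_l; rewrite f0 => f1.
by apply/eqP; rewrite -lex0 f1 linear_le_top.
Qed.

(** If [f] maps each of two complementary elements below itself, then it is the
direct sum of its restrictions, so it commutes with the projection. *)
Lemma stable_proj_comm x x' : modular_lattice L -> complement x x' ->
  f x <= x -> f x' <= x' -> proj x x' \o f = f \o proj x x'.
Proof.
move=> L_modular xx' fx fx'; apply/funext => a /=.
have faU : f a `|` x' = f (proj x x' a) `|` x'.
  have fxU b : f b `|` x' = f (b `|` x') `|` x'.
    by rewrite linear_join -joinA (join_r fx').
  by rewrite fxU [RHS]fxU join_proj.
rewrite {1}/proj faU -/(proj x x' _) proj_id //.
exact/(le_trans _ fx)/linear_mono/proj_le.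
Qed.

End LinearEndomorphisms.

Section Submonoids.
Variables (d : Order.disp_t) (L : tbLatticeType d) (m : set (L -> L)).
Hypothesis L_modular : modular_lattice L.
Hypothesis m_submonoid : submonoid_with_zero m.
Hypothesis m_compl : closed_under_complements m.
Implicit Types (f : L -> L) (x y : L).

Lemma m_linear f : m f -> linear_morphism f.
Proof. by case: m_submonoid => m_lin _ _ _; exact: m_lin. Qed.

Lemma m_comp f g : m f -> m g -> m (f \o g).
Proof. by case: m_submonoid => _ _ _; apply. Qed.

(** Closure under complements for the identity map, whose restriction to
[[\bot, x]] is its own inverse. *)
Lemma m_proj x x' : complement x x' -> m (proj x x').
Proof.
move=> xx'; have [_ m_id _ _] := m_submonoid.
have id_iso : segment_iso (idfun : L -> L) \bot x \bot x.
  by split=> //; split=> // [y z _ _ //|y xy]; exists y.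
have := m_compl m_id (ex_intro _ x' xx') xx' id_iso.
congr m; apply/funext => a /=.
apply: (@pinvKV _ _ _ (segment \bot x) idfun) => [y z _ _ //|].
by apply/mem_set; rewrite /segment /= le0x proj_le.
Qed.

(** Let [k'] be a complement of [ker f] and [h] the projection onto [k'] along
[ker f].  Centrality turns [f \o h = f] into [h \o f = f], so [f \top <= k']. *)
Lemma image_meets_ker_trivially f : abelian m -> m f ->
  has_complement (ker f) -> f \top `&` ker f = \bot.
Proof.
move=> m_ab mf [k' kk']; have k'k := complement_sym kk'.
have h_central := m_ab _ (m_proj k'k).
have fh a : f (proj k' (ker f) a) = f a.
  by rewrite (linear_ker (m_linear mf)) join_proj // -linear_ker //; exact: m_linear.
have f1k' : f \top <= k'.
  rewrite -[f _]fh -/((f \o _) _) -h_central ?proj_le //.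
  by apply/funext => a /=; rewrite proj_id ?proj_le.
by apply/eqP; rewrite -lex0 -(proj1 k'k) leI2.
Qed.

(** Let [y'] be a complement of [f \top] and [e] the projection onto [f \top]
along [y'].  Centrality turns [e \o f = f] into [f \o e = f], so [f] kills
[y'], as [e] does. *)
Lemma image_joins_ker_top f : abelian m -> m f ->
  has_complement (f \top) -> ker f `|` f \top = \top.
Proof.
move=> m_ab mf [y' yy'].
have e_central : proj (f \top) y' \o f = f \o proj (f \top) y'.
  apply: (m_ab _ _ _ _ mf); first exact: m_proj.
  by apply/funext => a /=; rewrite proj_id ?proj_le.
have y'k : y' <= ker f.
  apply/(linear_eq0 (m_linear mf)).
  have /(congr1 (@^~ y')) /= := e_central.
  rewrite proj_id ?(linear_le_top (m_linear mf)) // => ->.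
  rewrite (iffRL (proj_eq0 L_modular y' yy')) //.
  by apply/(linear_eq0 (m_linear mf))/le0x.
by apply/eqP; rewrite -le1x -[leLHS](proj2 yy') joinC leU2.
Qed.

(** The composite [proj x' x \o f \o proj x x'] has square zero because
[proj x x' \o proj x' x] is zero, and its vanishing at [\top] says that
[proj x' x] kills [f x]. *)
Lemma image_stable f x x' : (forall g, m g -> g \top `&` ker g = \bot) ->
  complement x x' -> m f -> f x <= x.
Proof.
move=> m_disj xx' mf; have x'x := complement_sym xx'.
pose g := proj x' x \o (f \o proj x x').
have mg : m g by do !apply: m_comp => //; exact: m_proj.
apply/(proj_eq0 L_modular _ x'x); rewrite -[in f x](proj_top x x') -/(g \top).
apply: (square_zero (m_linear mg)) => [|a]; first exact: m_disj.
rewrite /g /= (iffRL (proj_eq0 L_modular _ xx')) ?proj_le //.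
rewrite (iffRL (linear_eq0 (m_linear mf) _)) ?le0x //.
by apply/proj_eq0 => //; exact: le0x.
Qed.

End Submonoids.

Theorem proposition3p27 (d : Order.disp_t) (L : tbLatticeType d)
    (m : set (L -> L))
    (L_complete : complete_lattice L) (L_modular : modular_lattice L)
    (m_submonoid : submonoid_with_zero m)
    (m_compl : closed_under_complements m) :
  (rickart m /\ dual_rickart m /\ abelian m) <->
  (forall f : L -> L, m f ->
     \bot = f \top `&` ker f /\ \top = ker f `|` f \top).
Proof.
split=> [[m_ri [m_dri m_ab]] f mf|mb].
  split; apply/esym.
    by apply: (image_meets_ker_trivially L_modular m_submonoid m_compl) (m_ri _ _).
  by apply: (image_joins_ker_top L_modular m_submonoid m_compl) (m_dri _ _).
have m_cplt f : m f -> complement (f \top) (ker f).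
  by move=> /mb[f0 f1]; split=> //; rewrite joinC.
split; [|split] => [f mf|f mf|e me ee f mf].
- by exists (f \top); apply/complement_sym/m_cplt.
- by exists (ker f); exact: m_cplt.
have ek := m_cplt _ me; have f_lin := m_linear m_submonoid mf.
have stable x x' : complement x x' -> f x <= x.
  move=> xx'; apply: (image_stable L_modular m_submonoid m_compl _ xx' mf).
  by move=> g /m_cplt[].
rewrite (idempotent_proj (m_linear m_submonoid me) L_modular ee ek).
apply: stable_proj_comm => //; first exact: stable ek.
exact/stable/complement_sym/ek.
Qed.
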